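(* Consider the multi-agent goal recognition problem, the hypothesis score $S_t$, the local team-goal scores $S_t(T_k,g)$, and the online branch-and-bound procedure defined in the context, and suppose the score is non-competitive. Then: (1) For every step $t$ and every complete hypothesis $h=(P,g_1,\dots,g_K)$ with $P=\{T_1,\dots,T_K\}\in\mathcal P$ and $g_k\in\mathcal G_k$, $$S_t(P,g_1,\dots,g_K)=\sum_{k=1}^{K} S_t(T_k,g_k).$$ (2) None of the three pruning tests of the procedure can discard a complete hypothesis whose score exceeds the current floor $F$. That is, at any step $t$ and any moment in the run at which a test is evaluated, with $F$ the value of the floor at that moment: (a) (scoring-stage test) if partition $P$ is skipped because the heap is full and its stale bound satisfies $\widetilde U_t(P)\le F$, then $S_t(P,g_1,\dots,g_K)\le F$ for all $(g_1,\dots,g_K)\in\mathcal G_1\times\cdots\times\mathcal G_K$; (b) (partition-level test) if partition $P$ is dropped after refresh because the heap is full and $U_t(P)\le F$, then $S_t(P,g_1,\dots,g_K)\le F$ for all $(g_1,\dots,g_K)\in\mathcal G_1\times\cdots\times\mathcal G_K$; (c) (local-level test) if the tuple expansion inside partition $P$ is stopped because the heap is full and the best score of a tuple in the queue is $\le F$, then every complete hypothesis with partition $P$ that has not been emitted at step $t$ has score $S_t\le F$.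
   Context: **Problem.** $A=\{1,\dots,N\}$ is a finite set of agents. $\mathcal P$ is a finite set of candidate indexed partitions $P=\{T_1,\dots,T_K\}$ of $A$ into $K$ disjoint teams with $\bigcup_k T_k=A$; the index $k$ is a team-slot label. For each slot $k$, $\mathcal G_k$ is a finite nonempty set of candidate goals. A complete hypothesis is $h=(P,g_1,\dots,g_K)$ with $P\in\mathcal P$, $g_k\in\mathcal G_k$. The observer sees a trajectory $(s_\tau,a_\tau)_{\tau=1}^{t}$ of world states and joint actions $a_\tau=(a_\tau^1,\dots,a_\tau^N)$, revealed one step at a time. Action spaces are finite, and $\pi_\theta(\cdot\mid o,c)$ is a fixed policy giving a probability distribution over actions for each policy input $o$ and teammate-action context $c$. **Score.** Given $h$, let $o_\tau^i(h)$ be the policy input for agent $i$ built from $s_\tau$ and the team and goal features specified by $h$ for agent $i$. Let $c_\tau^i(h)$ be the tuple of recorded actions (from $a_\tau$) of the agents that $h$ places in the same team as $i$ and that are earlier than $i$ in a fixed within-team order. Fix $\varepsilon\in(0,1)$ and $\lambda>0$. The hypothesis score is $$S_t(h)=\sum_{\tau=1}^{t}\sum_{i=1}^{N}\log\max\big(\pi_\theta(a_\tau^i\mid o_\tau^i(h),c_\tau^i(h)),\varepsilon\big),$$ with two conventions. If $a_\tau^i$ is infeasible under the action constraints of $h$, the $(\tau,i)$ term is replaced by $\log\varepsilon$. If $t$ is the final step of a trajectory that has terminated without truncation, then for each team $k$ whose candidate goal $g_k$ is not satisfied in the final state, $\lambda$ is subtracted once (terminal penalty). **Non-competitive score.** The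 score is non-competitive if, for the fixed observed trajectory and any partition $P$, each agent-level term for $i\in T_k$ and any terminal penalty for team $k$ depend on $T_k$ and $g_k$, but not on the candidate goals of the other teams. The inputs and contexts for $i\in T_k$ are then written $o_\tau^i(T_k,g_k)$ and $c_\tau^i(T_k,g_k)$. **Local score.** For $P=\{T_1,\dots,T_K\}$ and $g\in\mathcal G_k$, $$S_t(T_k,g)=\sum_{\tau=1}^{t}\sum_{i\in T_k}\log\max\big(\pi_\theta(a_\tau^i\mid o_\tau^i(T_k,g),c_\tau^i(T_k,g)),\varepsilon\big),$$ with infeasible actions again contributing $\log\varepsilon$, and with $\lambda$ subtracted once if the trajectory has terminated without truncation at step $t$ and $g$ is unsatisfied in the final state. By convention $S_0(T_k,g)=0$. **Bounds.** The partition bound is $U_t(P)=\sum_{k=1}^K\max_{g\in\mathcal G_k}S_t(T_k,g)$. The stale bound $\widetilde U_t(P)$ available at the start of step $t$ is $U_{t'}(P)$, where $t'<t$ is the last earlier step at which the local scores of $P$ were refreshed, and $\widetilde U_t(P)=U_0(P)=0$ if they were never refreshed. **Procedure** (retained list size $m\ge1$). At each step $t$: - Start with an empty min-heap $\mathcal H$ of capacity $m$ and $F=-\infty$. Process the partitions of $\mathcal P$ in descending order of $\widetilde U_t(P)$. - *Scoring-stage test:* if $\mathcal H$ is full and $\widetilde U_t(P)\le F$, skip $P$. Otherwise refresh, i.e. compute $S_t(T_k,g)$ for all $k$ and all $g\in\mathcal G_k$, and compute $U_t(P)$. - *Partition-level test:* if $\mathcal H$ is full and $U_t(P)\le F$,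 drop $P$. Otherwise sort each $\mathcal G_k$ by $S_t(T_k,\cdot)$ in descending order. An index tuple $(j_1,\dots,j_K)$ denotes the complete hypothesis using the $j_k$-th goal of the $k$-th sorted list for every $k$; its score is the sum of the selected local scores. Initialize a max-priority queue (keyed by tuple score) and a set *seen*, both containing only $(1,\dots,1)$. - *Local loop with local-level test:* while the queue is nonempty, fewer than $m$ tuples have been emitted for this partition at this step, and either $\mathcal H$ is not full or the best tuple score in the queue exceeds $F$: pop the best tuple, emit its complete hypothesis, and insert it into $\mathcal H$ if it belongs to the current top-$m$ set (removing the lowest entry if over capacity). Then push each one-coordinate successor (one $j_k$ increased by $1$, within range) not in *seen* onto the queue and add it to *seen*. - After each partition (whether skipped, dropped or searched), if $\mathcal H$ is full, set $F$ to the smallest score in $\mathcal H$. - At the end of the step, each refreshed $U_t(P)$ becomes the stale bound of $P$, and $\mathcal H$ is output as the ranking for step $t$. *)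

(* Defs.v *)
(* MathComp + MathComp-Analysis; agents, team slots and time are indexed by
   'I_N, 'I_K and nat. *)
From mathcomp Require Import all_boot all_order all_algebra.
From mathcomp Require Import reals constructive_ereal exp.
Import Order.TTheory GRing.Theory Num.Theory.

Set Implicit Arguments.
Unset Strict Implicit.
Unset Printing Implicit Defensive.

Local Open Scope ring_scope.

Notation teams N K := {ffun 'I_K -> {set 'I_N}}.

(* A hypothesis (P, (g_1, ..., g_K)).  Slots draw their goals from subsets of one
   ambient finite type of goals. *)
Notation hypothesis N K Goal := (teams N K * {ffun 'I_K -> Goal})%type.

(* Teams may be empty: only disjointness and covering are imposed. *)
Definition indexed_partition (N K : nat) (P : teams N K) : bool :=
  [forall k, forall l, (k != l) ==> [disjoint P k & P l]]
  && (\bigcup_k P k == [set: 'I_N]).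

(* A problem instance together with one observed trajectory.  Only the values
   of [state] and [action] at the times 1, ..., [len] are meaningful. *)
Record problem (R : realType) (N K : nat) (Goal Act : finType)
    (State Obs : Type) := Problem {
  cand_part : {set teams N K};
  cand_partP : forall P, P \in cand_part -> indexed_partition P;
  cand_goal : 'I_K -> {set Goal};
  cand_goal_neq0 : forall k, cand_goal k != set0;
  (* the within-team order, as an enumeration of every possible team *)
  team_order : {set 'I_N} -> seq 'I_N;
  team_orderP : forall T, perm_eq (team_order T) (enum T);
  policy : Obs -> seq Act -> Act -> R;
  policy_ge0 : forall o c a, 0 <= policy o c a;
  policy_sum1 : forall o c, \sum_a policy o c a = 1;
  input : State -> hypothesis N K Goal -> 'I_N -> Obs;
  (* [feasible s a h i]: in the joint action [a] taken in the state [s], the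
     action of agent [i] respects the action constraints of [h] *)
  feasible : State -> {ffun 'I_N -> Act} -> hypothesis N K Goal -> 'I_N -> bool;
  satisfied : State -> hypothesis N K Goal -> 'I_K -> bool;
  eps : R;
  eps_gt0 : 0 < eps;
  eps_lt1 : eps < 1;
  lambda : R;
  lambda_gt0 : 0 < lambda;
  len : nat;
  state : nat -> State;
  action : nat -> {ffun 'I_N -> Act};
  final_state : State;
  (* the trajectory terminates without truncation at its step [len] *)
  terminated : bool
}.

Section Scores.
Context {R : realType} {N K : nat} {Goal Act : finType} {State Obs : Type}.
Variable M : problem R N K Goal Act State Obs.
Implicit Types (t tau : nat) (i : 'I_N) (k : 'I_K) (T : {set 'I_N}) (g : Goal).
Implicit Types (P : teams N K) (h : hypothesis N K Goal).

Definition complete h : bool :=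
  (h.1 \in cand_part M) && [forall k, h.2 k \in cand_goal M k].

Definition team_of P i : {set 'I_N} :=
  [set j | [exists k, (i \in P k) && (j \in P k)]].

Definition context tau T i : seq Act :=
  [seq action M tau j
     | j <- take (index i (team_order M T)) (team_order M T)].

Definition agent_term tau h i : R :=
  if feasible M (state M tau) (action M tau) h i then
    ln (Num.max (policy M (input M (state M tau) h i)
                          (context tau (team_of h.1 i) i)
                          (action M tau i))
                (eps M))
  else ln (eps M).

(* The conjunct [0 < t] is the convention that scores vanish at t = 0. *)
Definition ends_at t : bool := [&& (0 < t)%N, t == len M & terminated M].

Definition penalty t h k : R :=
  if ends_at t && ~~ satisfied M (final_state M) h k then lambda M else 0.

Definition score t h : R :=
  \sum_(1 <= tau < t.+1) \sum_i agent_term tau h i - \sum_k penalty t h k.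

Definition noncompetitive : Prop :=
  forall h h' k k', complete h -> complete h' ->
    h.1 k = h'.1 k' -> h.2 k = h'.2 k' ->
    (forall tau i, (0 < tau <= len M)%N -> i \in h.1 k ->
       agent_term tau h i = agent_term tau h' i)
    /\ (forall t, (0 < t <= len M)%N -> penalty t h k = penalty t h' k').

(* [h] is a complete hypothesis whose slot [k] holds the team [T] with goal [g]. *)
Definition realizes T g (hk : hypothesis N K Goal * 'I_K) : bool :=
  [&& complete hk.1, hk.1.1 hk.2 == T & hk.1.2 hk.2 == g].

(* S_t(T, g).  The inputs o(T, g), contexts c(T, g), feasibility and goal
   satisfaction are read off any complete hypothesis giving the goal [g] to the
   team [T]: for a non-competitive score the value does not depend on which one.
   The value 0 is for pairs occurring in no complete hypothesis. *)
Definition local_score t T g : R :=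
  if [pick hk | realizes T g hk] is Some (h, k) then
    \sum_(1 <= tau < t.+1) \sum_(i in T) agent_term tau h i - penalty t h k
  else 0.

Definition goal0 k : Goal :=
  xchoose (elimT (set0Pn (cand_goal M k)) (cand_goal_neq0 M k)).

(* [goal0 k] belongs to [cand_goal M k], so each summand is a maximum over
   [cand_goal M k]. *)
Definition partition_bound t P : R :=
  \sum_k \big[Num.max/local_score t (P k) (goal0 k)]_(g in cand_goal M k)
           local_score t (P k) g.

Definition sum_score t h : R := \sum_k local_score t (h.1 k) (h.2 k).

End Scores.

Section Procedure.
Context {R : realType} {N K : nat} {Goal Act : finType} {State Obs : Type}.
Variables (M : problem R N K Goal Act State Obs) (m : nat).

Notation part := (teams N K).
Notation hyp := (hypothesis N K Goal).

(* Index tuples, with indices starting at 0. *)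
Notation itup := {ffun 'I_K -> nat}.

Implicit Types (t n : nat) (P : part) (h : hyp) (H em : seq hyp) (F : \bar R).
Implicit Types (last : {ffun part -> nat}) (refr : {set part}).
Implicit Types (todo : seq part) (srt : {ffun 'I_K -> seq Goal}) (j : itup).
Implicit Types (queue seen : seq itup).

Definition tuple_hyp P srt j : hyp :=
  (P, [ffun k => nth (goal0 M k) (srt k) (j k)]).

Definition tuple_score t P srt j : R := sum_score M t (tuple_hyp P srt j).

Definition best_tuple t P srt queue j : Prop :=
  j \in queue /\
  forall j', j' \in queue -> tuple_score t P srt j' <= tuple_score t P srt j.

Definition succ_tuple j k : itup := [ffun l => if l == k then (j l).+1 else j l].

Definition new_tuples srt j seen : seq itup :=
  [seq succ_tuple j k | k <- enum 'I_K &
     ((j k).+1 < size (srt k))%N && (succ_tuple j k \notin seen)].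

Definition goals_sorted t P srt : Prop := forall k,
  perm_eq (srt k) (enum (cand_goal M k)) /\
  sorted (fun g g' => local_score M t (P k) g' <= local_score M t (P k) g)
         (srt k).

(* [last P] is the last step that refreshed [P], and 0 if there is none. *)
Definition stale_bound last P : R := partition_bound M (last P) P.

Definition parts_sorted last todo : Prop :=
  perm_eq todo (enum (cand_part M)) /\
  sorted (fun P Q => stale_bound last Q <= stale_bound last P) todo.

(* The heap is the sequence of its entries, keyed by [sum_score M t]. *)
Definition full H : bool := size H == m.

Definition floor_update t H F : \bar R :=
  if full H then \big[Order.min/+oo%E]_(h <- H) (sum_score M t h)%:E else F.

(* In a full heap a lowest entry of [h :: H] is removed, ties being broken
   arbitrarily; this entry is [h] itself when [h] does not enter the current
   top-m set. *)
Definition heap_insert t H h (H' : seq hyp) : Prop :=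
  if full H then
    exists2 h0, h0 \in h :: H &
      (forall h1, h1 \in h :: H -> sum_score M t h0 <= sum_score M t h1)
      /\ H' = rem h0 (h :: H)
  else H' = h :: H.

(* Control points of a run:
   - [Idle]: between two steps;
   - [ScoringTest todo]: the scoring-stage test of the head of [todo] is to be
     evaluated, or the step is over if [todo] is empty;
   - [PartitionTest P todo]: [P] has just been refreshed;
   - [LocalTest P srt queue seen n todo]: the guard of the local loop of [P] is
     to be evaluated, [n] tuples having been emitted by this loop. *)
Inductive phase :=
  | Idle
  | ScoringTest of seq part
  | PartitionTest of part & seq part
  | LocalTest of part & {ffun 'I_K -> seq Goal} & seq itup & seq itup & nat
      & seq part.

Record config := Config {
  cstep : nat;
  clast : {ffun part -> nat};
  crefreshed : {set part};   (* the partitions refreshed during this step *)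
  cheap : seq hyp;
  cfloor : \bar R;
  cemitted : seq hyp;        (* the hypotheses emitted during this step *)
  cphase : phase
}.

(* All orders of processing, sorts and pops compatible with the keys are
   allowed: ties are broken nondeterministically. *)
Inductive transition : config -> config -> Prop :=
  | StartStep t last refr H F em todo :
      (t < len M)%N -> parts_sorted last todo ->
      transition (Config t last refr H F em Idle)
                 (Config t.+1 last set0 [::] -oo%E [::]
                         (ScoringTest todo))
  | Skip t last refr H F em P todo :
      full H -> ((stale_bound last P)%:E <= F)%E ->
      transition (Config t last refr H F em (ScoringTest (P :: todo)))
                 (Config t last refr H (floor_update t H F) em
                         (ScoringTest todo))
  | Refresh t last refr H F em P todo :
      ~~ (full H && ((stale_bound last P)%:E <= F)%E) ->
      transition (Config t last refr H F em (ScoringTest (P :: todo)))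
                 (Config t last (P |: refr)%SET H F em (PartitionTest P todo))
  | Drop t last refr H F em P todo :
      full H -> ((partition_bound M t P)%:E <= F)%E ->
      transition (Config t last refr H F em (PartitionTest P todo))
                 (Config t last refr H (floor_update t H F) em
                         (ScoringTest todo))
  | Open t last refr H F em P todo srt :
      ~~ (full H && ((partition_bound M t P)%:E <= F)%E) ->
      goals_sorted t P srt ->
      transition (Config t last refr H F em (PartitionTest P todo))
                 (Config t last refr H F em
                    (LocalTest P srt [:: [ffun=> 0%N]] [:: [ffun=> 0%N]] 0 todo))
  | Emit t last refr H F em P todo srt queue seen n j H' :
      best_tuple t P srt queue j -> (n < m)%N ->
      ~~ full H || (F < (tuple_score t P srt j)%:E)%E ->
      heap_insert t H (tuple_hyp P srt j) H' ->
      transition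
        (Config t last refr H F em (LocalTest P srt queue seen n todo))
        (Config t last refr H' F (tuple_hyp P srt j :: em)
           (LocalTest P srt (new_tuples srt j seen ++ rem j queue)
                      (new_tuples srt j seen ++ seen) n.+1 todo))
  | Close t last refr H F em P todo srt queue seen n :
      [\/ queue = [::], (m <= n)%N
        | full H /\ exists2 j, best_tuple t P srt queue j &
                      ((tuple_score t P srt j)%:E <= F)%E] ->
      transition (Config t last refr H F em (LocalTest P srt queue seen n todo))
                 (Config t last refr H (floor_update t H F) em
                         (ScoringTest todo))
  | EndStep t last refr H F em :
      transition (Config t last refr H F em (ScoringTest [::]))
                 (Config t [ffun P => if P \in refr then t else last P]
                         refr H F em Idle).

Definition initial_config : config :=
  Config 0 [ffun=> 0%N] set0 [::] -oo%E [::] Idle.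

Inductive reachable : config -> Prop :=
  | ReachInit : reachable initial_config
  | ReachStep c c' : reachable c -> transition c c' -> reachable c'.

End Procedure.

Arguments config R N K Goal : clear implicits.

(* Main.v *)
(* The logarithms are nonpositive and the penalty is charged only at the last
   step, so local scores decrease in time and a stale bound is still an upper
   bound.  In the local search, every index tuple which has not been emitted is
   dominated coordinatewise by a tuple in the queue: walking from (0, ..., 0) up
   to it one coordinate at a time, the walk stays among seen tuples until it
   meets the queue. *)
Require Import Defs.
From mathcomp Require Import all_boot all_order all_algebra.
From mathcomp Require Import reals constructive_ereal exp.
Import Order.TTheory GRing.Theory Num.Theory.

Local Open Scope ring_scope.

(** * Scores: monotonicity in time and decomposition over teams *)

Section Scores.
Context {R : realType} {N K : nat} {Goal Act : finType} {State Obs : Type}.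
Variable M : problem R N K Goal Act State Obs.
Implicit Types (t tau : nat) (i : 'I_N) (k : 'I_K) (P : teams N K)
  (h : hypothesis N K Goal).

Lemma policy_le1 o c a : policy M o c a <= 1.
Proof.
rewrite -(policy_sum1 M o c) (bigD1 a) //= lerDl.
by apply: sumr_ge0 => b _; exact: policy_ge0.
Qed.

Lemma agent_term_le0 tau h i : agent_term M tau h i <= 0.
Proof.
rewrite /agent_term; case: ifP => _; apply: ln_le0; last exact/ltW/eps_lt1.
by rewrite ge_max policy_le1 ltW ?eps_lt1.
Qed.

Lemma penalty_ge0 t h k : 0 <= penalty M t h k.
Proof. by rewrite /penalty; case: ifP => // _; exact/ltW/lambda_gt0. Qed.

Lemma penalty_before_end t h k : (t < len M)%N -> penalty M t h k = 0.
Proof. by move=> lt_t; rewrite /penalty /ends_at (ltn_eqF lt_t) andbF. Qed.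

(** The hypothesis chosen by [pick] does not depend on time, so both sides read the same terms:
    later steps only add nonpositive logarithms. The bound by [len M] matters, since past the end
    the penalty would no longer be charged. *)
Lemma local_score_anti t' t (T : {set 'I_N}) g :
  (t' <= t <= len M)%N -> local_score M t T g <= local_score M t' T g.
Proof.
case/andP=> le_t't le_t; rewrite /local_score; case: pickP => // -[h k] _.
move: le_t't; rewrite leq_eqVlt => /predU1P[-> //|lt_t't].
(* As [t' < t <= len M], the earlier score carries no penalty, while the later one may. *)
rewrite (penalty_before_end t') ?(leq_trans lt_t't) // subr0.
rewrite -[leRHS]subr0; apply: lerB; last exact: penalty_ge0.
rewrite (big_cat_nat _ (n := t'.+1)) //= 1?ltnW // gerDl.
by apply: sumr_le0 => tau _; apply: sumr_le0 => i _; exact: agent_term_le0.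
Qed.

(** Several slots may hold the empty team, so the sum is split along an indexed disjoint union
    rather than along a set of blocks. *)
Lemma sum_indexed_partition P (F : 'I_N -> R) :
  Defs.indexed_partition P -> \sum_i F i = \sum_k \sum_(i in P k) F i.
Proof.
case/andP=> disjP /eqP coverP.
rewrite -partition_disjoint_bigcup /= => [|k l].
  by apply: eq_bigl => i; rewrite coverP inE.
by apply/implyP; have /forallP := forallP disjP k.
Qed.

Lemma score_local t h : noncompetitive M -> (0 < t <= len M)%N ->
  complete M h -> score M t h = sum_score M t h.
Proof.
move=> nc t_bounds hC; have /andP[hP _] := hC.
have agents tau := @sum_indexed_partition h.1 (agent_term M tau h) (cand_partP hP).
rewrite /score (eq_bigr _ (fun tau _ => agents tau)) exchange_big -sumrB.
(* The pick cannot fail, as [(h, k)] itself qualifies. It may return another hypothesis and another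
   slot, and non-competitiveness identifies the two contributions. *)
apply: eq_bigr => k _; rewrite /local_score; case: pickP => [[h' k']|]; last first.
  by move=> /(_ (h, k)); rewrite /realizes /= hC !eqxx.
case/and3P=> /= h'C /eqP eqT /eqP eqg.
have [terms pens] := nc h h' k k' hC h'C (esym eqT) (esym eqg).
rewrite pens //; congr (_ - _); apply: eq_big_nat => tau /andP[tau0 tau_t].
apply: eq_bigr => i iT; apply: terms => //; rewrite tau0 /=.
by case/andP: t_bounds => _; apply: leq_trans.
Qed.

(** Serves both bound tests: [t'] is the last refresh (0 if none) for the stale bound, and [t' = t]
    for the fresh one. *)
Lemma sum_score_le_bound t' t P (g : {ffun 'I_K -> Goal}) :
  (t' <= t <= len M)%N -> (forall k, g k \in cand_goal M k) ->
  sum_score M t (P, g) <= partition_bound M t' P.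
Proof.
move=> le_t gC; apply: ler_sum => k _ /=.
apply: le_trans (local_score_anti _ _ _ _ le_t) _.
exact: (le_bigmax_cond _ (fun g => local_score M t' (P k) g) (gC k)).
Qed.

End Scores.

(** * The local search and its frontier *)

Section Search.
Context {R : realType} {N K : nat} {Goal Act : finType} {State Obs : Type}.
Variables (M : problem R N K Goal Act State Obs) (m : nat).
Notation itup := {ffun 'I_K -> nat}.
Notation hyp := (hypothesis N K Goal).
Implicit Types (t : nat) (k : 'I_K) (P : teams N K)
  (srt : {ffun 'I_K -> seq Goal}) (i j q s : itup) (em : seq hyp).

Definition in_range srt j := forall k, (j k < size (srt k))%N.

Lemma tuple_score_anti t P srt i j : goals_sorted M t P srt ->
  in_range srt j -> (forall k, (i k <= j k)%N) ->
  tuple_score M t P srt j <= tuple_score M t P srt i.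
Proof.
move=> sortP jR le_ij; apply: ler_sum => k _ /=; rewrite !ffunE.
have [_ srtk] := sortP k.
have tr : transitive (fun g g' => local_score M t (P k) g' <= local_score M t (P k) g).
  by move=> y x z xy yz; exact: le_trans yz xy.
apply: (sorted_leq_nth tr) => //; rewrite ?inE //.
exact: leq_ltn_trans (le_ij k) (jR k).
Qed.

Lemma tuple_of_goals t P srt (g : {ffun 'I_K -> Goal}) :
  goals_sorted M t P srt -> (forall k, g k \in cand_goal M k) ->
  exists2 j, in_range srt j & tuple_hyp M P srt j = (P, g).
Proof.
move=> sortP gC; have g_srt k : g k \in srt k.
  by have [/perm_mem-> _] := sortP k; rewrite mem_enum.
exists [ffun k => index (g k) (srt k)] => [k|]; first by rewrite ffunE index_mem.
by congr (_, _); apply/ffunP => k; rewrite !ffunE nth_index.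
Qed.

(** A seen tuple that has left the queue has been expanded: its hypothesis is emitted and all its
    successors within range are seen. *)
Definition search_inv P srt (queue seen : seq itup) em :=
  [ffun=> 0%N] \in seen /\
  forall s, s \in seen -> s \in queue \/
    tuple_hyp M P srt s \in em /\
    forall k, ((s k).+1 < size (srt k))%N -> succ_tuple s k \in seen.

Lemma search_inv_init P srt em :
  search_inv P srt [:: [ffun=> 0%N]] [:: [ffun=> 0%N]] em.
Proof. by split=> [|s]; [rewrite inE | left]. Qed.

Lemma search_inv_emit P srt queue seen em j :
  search_inv P srt queue seen em -> j \in queue ->
  search_inv P srt (new_tuples srt j seen ++ rem j queue)
    (new_tuples srt j seen ++ seen) (tuple_hyp M P srt j :: em).
Proof.
move=> [seen0 seenP] jq; split=> [|s]; first by rewrite mem_cat seen0 orbT.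
rewrite mem_cat; case: (boolP (s \in new_tuples _ _ _)) => [sn _|_ /= /seenP].
  by left; rewrite mem_cat sn.
case=> [sq|[s_em succs]]; last first.
  right; split=> [|k /succs]; first by rewrite inE s_em orbT.
  by rewrite mem_cat orbC => ->.
(* Only the popped [j] changes status; each of its successors is either pushed now or was already
   seen. *)
have [->|neq_sj] := eqVneq s j; last first.
  left; rewrite mem_cat; apply/orP; right.
  by move: sq; rewrite (perm_mem (perm_to_rem jq)) inE (negPf neq_sj).
right; split=> [|k lt_k]; first exact: mem_head.
rewrite mem_cat; case: (boolP (succ_tuple j k \in seen)) => [|nseen].
  by rewrite orbT.
rewrite orbF; apply/mapP; exists k => //.
by rewrite mem_filter mem_enum lt_k nseen.
Qed.

Lemma search_frontier P srt queue seen em j :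
  search_inv P srt queue seen em -> in_range srt j ->
  tuple_hyp M P srt j \notin em ->
  exists2 q, q \in queue & forall k, (q k <= j k)%N.
Proof.
move=> [seen0 seenP] jR jN.
(* Induction on a strict bound [d] for the number of unit steps left from [s] to [j]. *)
have walk d s : s \in seen -> (forall k, (s k <= j k)%N) ->
    (\sum_k (j k - s k) < d)%N ->
    exists2 q, q \in queue & forall k, (q k <= j k)%N.
  elim: d s => [//|d IHd] s s_seen le_sj lt_d.
  have [sq|[s_em succs]] := seenP s s_seen; first by exists s.
  (* If no coordinate were smaller, [s] would be [j], whose hypothesis is not emitted. Raising
     coordinate [k] stays below [j], hence within range, so the successor is seen. *)
  have /existsP[k lt_k] : [exists k, s k < j k]%N.
    apply: contraNT jN => /existsPn ge_sj; suff -> : j = s by [].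
    by apply/ffunP => k; apply/eqP; rewrite eqn_leq le_sj leqNgt ge_sj.
  apply: (IHd (succ_tuple s k)) => [|l|].
  - exact/succs/(leq_ltn_trans lt_k).
  - by rewrite ffunE; case: eqP => // ->.
  rewrite -ltnS; apply: leq_trans lt_d; rewrite ltnS.
  (* Only the summand at [k] changes; it drops by exactly one because it was positive. *)
  rewrite (bigD1 k) //= [X in (_ < X)%N](bigD1 k) //= ffunE eqxx.
  rewrite (eq_bigr (fun l => j l - s l)%N) => [|l /negPf neq_lk].
    by rewrite ltn_add2r subnS prednK ?subn_gt0.
  by rewrite ffunE neq_lk.
by apply: (walk _ _ seen0 _ (ltnSn _)) => k; rewrite ffunE.
Qed.

Lemma unemitted_le_best t P srt queue seen em j (g : {ffun 'I_K -> Goal}) :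
  goals_sorted M t P srt -> search_inv P srt queue seen em ->
  best_tuple M t P srt queue j -> (forall k, g k \in cand_goal M k) ->
  (P, g) \notin em -> sum_score M t (P, g) <= tuple_score M t P srt j.
Proof.
move=> sortP inv [_ best] gC; have [i iR <-] := tuple_of_goals _ _ _ _ sortP gC.
move=> iN; have [q qq le_qi] := search_frontier _ _ _ _ _ _ inv iR iN.
exact: le_trans (tuple_score_anti _ _ _ _ _ sortP iR le_qi) (best q qq).
Qed.

(** * Invariants of reachable configurations *)

Definition phase_inv t em (ph : @phase N K Goal) : Prop :=
  match ph with
  | Idle => True
  | ScoringTest todo => (0 < t)%N /\ {subset todo <= cand_part M}
  | PartitionTest P todo => (0 < t)%N /\ {subset P :: todo <= cand_part M}
  | LocalTest P srt queue seen _ todo =>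
      [/\ (0 < t)%N, {subset P :: todo <= cand_part M},
          goals_sorted M t P srt & search_inv P srt queue seen em]
  end.

(** The two inequalities place each last refresh and the current step in the range where local
    scores decrease. The first inequality on refreshes is weak because they equal the current step
    once that step has ended. *)
Definition config_inv (c : config R N K Goal) : Prop :=
  [/\ (cstep c <= len M)%N, forall P, (clast c P <= cstep c)%N
    & phase_inv (cstep c) (cemitted c) (cphase c)].

Lemma reachable_inv c : reachable M m c -> config_inv c.
Proof.
elim=> [|{}c c' _ + tr]; first by split=> // P; rewrite ffunE.
have tl (P : teams N K) todo :
  {subset P :: todo <= cand_part M} -> {subset todo <= cand_part M}.
  by move=> sub Q Qt; apply: sub; rewrite inE Qt orbT.
case: tr => /=.
- move=> t last refr H F em todo lt_t [perm_todo _] [_ le_last _]; split=> //=.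
    by move=> P; exact: leqW.
  by split=> // P; rewrite (perm_mem perm_todo) mem_enum.
- by move=> t last refr H F em P todo _ _ [le_t le_last [t0 /tl sub]].
- by move=> t last refr H F em P todo _ [le_t le_last [t0 sub]].
- by move=> t last refr H F em P todo _ _ [le_t le_last [t0 /tl sub]].
- move=> t last refr H F em P todo srt _ sortP [le_t le_last [t0 sub]].
  by split=> //; split=> //; exact: search_inv_init.
- move=> t last refr H F em P todo srt queue seen n j H' [jq _] _ _ _.
  move=> [le_t le_last [t0 sub sortP inv]].
  by split=> //; split=> //; exact: search_inv_emit.
- by move=> t last refr H F em P todo srt queue seen n _ [le_t le_last [t0 /tl sub _ _]].
- move=> t last refr H F em [le_t le_last _]; split=> //= P.
  by rewrite ffunE; case: ifP.
Qed.

End Search.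

Theorem proposition1 (R : realType) (N K : nat) (Goal Act : finType)
    (State Obs : Type) (M : problem R N K Goal Act State Obs)
    (m : nat) (m_ge1 : (1 <= m)%N) (nc : noncompetitive M) :
  (forall (t : nat) (h : hypothesis N K Goal),
     (1 <= t <= len M)%N -> complete M h ->
     score M t h = \sum_(k < K) local_score M t (h.1 k) (h.2 k))
  /\
  (forall c : config R N K Goal, reachable M m c ->
     (* scoring-stage test *)
     (forall (P : teams N K) (todo : seq (teams N K)),
        cphase c = ScoringTest (P :: todo) ->
        full m (cheap c) ->
        ((stale_bound M (clast c) P)%:E <= cfloor c)%E ->
        forall g : {ffun 'I_K -> Goal}, (forall k, g k \in cand_goal M k) ->
          ((score M (cstep c) (P, g))%:E <= cfloor c)%E)
     /\
     (* partition-level test *)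
     (forall (P : teams N K) (todo : seq (teams N K)),
        cphase c = PartitionTest P todo ->
        full m (cheap c) ->
        ((partition_bound M (cstep c) P)%:E <= cfloor c)%E ->
        forall g : {ffun 'I_K -> Goal}, (forall k, g k \in cand_goal M k) ->
          ((score M (cstep c) (P, g))%:E <= cfloor c)%E)
     /\
     (* local-level test *)
     (forall (P : teams N K) (srt : {ffun 'I_K -> seq Goal})
             (queue seen : seq {ffun 'I_K -> nat}) (n : nat)
             (todo : seq (teams N K)) (j : {ffun 'I_K -> nat}),
        cphase c = LocalTest P srt queue seen n todo ->
        full m (cheap c) ->
        best_tuple M (cstep c) P srt queue j ->
        ((tuple_score M (cstep c) P srt j)%:E <= cfloor c)%E ->
        forall g : {ffun 'I_K -> Goal}, (forall k, g k \in cand_goal M k) ->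
          (P, g) \notin cemitted c ->
          ((score M (cstep c) (P, g))%:E <= cfloor c)%E)).
Proof.
split=> [t h t_bounds hC|c /reachable_inv[le_t le_last]]; first exact: score_local.
(* Part (1) turns each claim about [score] into one about sums of local scores, the quantity that
   the tests compare with the floor. *)
have to_sum P (g : {ffun 'I_K -> Goal}) : (0 < cstep c)%N -> P \in cand_part M ->
    (forall k, g k \in cand_goal M k) ->
    score M (cstep c) (P, g) = sum_score M (cstep c) (P, g).
  move=> t0 PC gC; apply: score_local; rewrite ?t0 //.
  by apply/andP; split=> //; apply/forallP.
move=> inv; split; last split.
- move=> P todo ph; rewrite ph in inv => _ le_F g gC; have [t0 sub] := inv.
  rewrite to_sum ?sub ?mem_head //; apply: le_trans le_F; rewrite lee_fin.
  by apply: sum_score_le_bound; rewrite // le_last le_t.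
- move=> P todo ph; rewrite ph in inv => _ le_F g gC; have [t0 sub] := inv.
  rewrite to_sum ?sub ?mem_head //; apply: le_trans le_F; rewrite lee_fin.
  by apply: sum_score_le_bound; rewrite // leqnn le_t.
move=> P srt queue seen n todo j ph; rewrite ph in inv => _ best le_F g gC gN.
have [t0 sub sortP sinv] := inv.
rewrite to_sum ?sub ?mem_head //; apply: le_trans le_F; rewrite lee_fin.
exact: unemitted_le_best sortP sinv best gC gN.
Qed.
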